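(* Let $p>3$ be a prime and $\delta\in\{\pm1\}$. If $p\equiv1\pmod4$, then $$T_p(2,5\delta,2)\equiv(-1)^{\lfloor(p+11)/12\rfloor}\pmod p.$$ If $p\equiv3\pmod4$, then $$T_p(2,5\delta,2)\equiv\left(\frac{6}{p}\right)\frac{\delta\,2^\delta}{3^\delta}\binom{(p-3)/2}{(p-3)/4}^{-2\delta}\pmod p.$$
   Context: $\left(\frac{\cdot}{p}\right)$ denotes the Legendre symbol. For an odd prime $p$ and $a,b,c\in\mathbb{Z}$, $T_p(a,b,c)=\prod_{i,j=1,\ p\nmid ai^2+bij+cj^2}^{(p-1)/2}(ai^2+bij+cj^2)$. Negative powers and fractions are interpreted as inverses modulo $p$. *)

(* Defs.v *)
From HB Require Import structures.
From mathcomp Require Import all_boot all_order all_algebra.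
Set Implicit Arguments. Unset Strict Implicit. Unset Printing Implicit Defensive.
Import Order.TTheory GRing.Theory Num.Theory.
Local Open Scope ring_scope.

Definition legendre (a : int) (p : nat) : int :=
  if ((p : int) %| a)%Z then 0
  else if [exists x : 'I_p, ((p : int) %| (x%:Z) ^+ 2 - a)%Z] then 1 else -1.

Definition qf (a b c : int) (i j : nat) : int :=
  a * (i%:Z) ^+ 2 + b * (i%:Z) * (j%:Z) + c * (j%:Z) ^+ 2.

Definition Tp (p : nat) (a b c : int) : int :=
  \prod_(1 <= i < (p.-1)./2.+1) \prod_(1 <= j < (p.-1)./2.+1 | ~~ ((p : int) %| qf a b c i j)%Z)
     qf a b c i j.

(* Main.v *)
(** Modulo p the form factors as d D(i,j) D(j,i), where d = delta and
    D(i,j) = 2i + d j, so by the symmetry i <-> j the product T_p is, up to the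
    sign d^n with n = (p-1)/2, a product of the squares D(i,j)^2.  Put
    P(a) = prod_(1 <= j <= n) (a - j)^2 with vanishing factors omitted.  Wilson's
    theorem gives P(a) P(-a) a^2 = 1, and shifting a gives P(-a) P(a+1) (a-n)^2 = 1.
    For d = -1 the product of the D(i,j)^2 is prod_i P(2i).  The residues 2i are
    the even numbers up to n and the negatives of the odd numbers up to n, and
    pairing P(-o) with P(o+1) evaluates the product through (floor(n/2))!.
    The case d = 1 follows from the case d = -1 by P(a) P(-a) a^2 = 1.  What
    remains is 6^n, given by Euler's criterion or, for p = 1 mod 4, by Gauss's
    lemma for 2 and 3. *)
Require Import Defs.
From HB Require Import structures.
From mathcomp Require Import all_boot all_order all_algebra finfield.
From mathcomp Require Import zify ring.
Import Order.TTheory GRing.Theory Num.Theory.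
Local Open Scope ring_scope.

(* The square of [x], with [0] replaced by [1] so that vanishing factors drop out of products. *)
Definition sqr_nz {F : fieldType} (x : F) : F := if x == 0 then 1 else x ^+ 2.

Lemma sqr_nzN (F : fieldType) (x : F) : sqr_nz (- x) = sqr_nz x.
Proof. by rewrite /sqr_nz oppr_eq0 sqrrN. Qed.

Lemma sqr_nz_id (F : fieldType) (x : F) : x != 0 -> sqr_nz x = x ^+ 2.
Proof. by rewrite /sqr_nz => /negPf->. Qed.

(** * Factorials and products over arithmetic progressions *)

Lemma natr_fact (R : comNzRingType) n : n`!%:R = \prod_(i < n) i.+1%:R :> R.
Proof. by rewrite fact_prod big_add1 big_mkord natr_prod. Qed.

Lemma prodrMc (R : comNzRingType) (c : R) n (G : 'I_n -> R) :
  \prod_(i < n) (c * G i) = c ^+ n * \prod_(i < n) G i.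
Proof. by rewrite big_split /= prodr_const card_ord. Qed.

Lemma prodr_even_odd (R : comNzRingType) m :
  (\prod_(t < m) t.*2.+2%:R) * (\prod_(t < m) t.*2.+1%:R) = (m.*2)`!%:R :> R.
Proof.
elim: m => [|m IHm]; first by rewrite !big_ord0 mulr1.
rewrite doubleS !factS !natrM -IHm !big_ord_recr /=; ring.
Qed.

Lemma prodr_even (R : comNzRingType) m :
  \prod_(t < m) t.*2.+2%:R = 2 ^+ m * m`!%:R :> R.
Proof.
by rewrite natr_fact -prodrMc; apply: eq_bigr => t _; rewrite -natrM mul2n doubleS.
Qed.

Lemma prodr_triples (R : comNzRingType) k :
  (\prod_(t < k) (3 * t + 3)%:R) * (\prod_(t < k) (3 * t + 1)%:R) *
  (\prod_(t < k) (3 * t + 2)%:R) = (3 * k)`!%:R :> R.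
Proof.
elim: k => [|k IHk]; first by rewrite !big_ord0 !mulr1.
rewrite mulnS !addSn add0n !factS !natrM -IHk !big_ord_recr /=; ring.
Qed.

Lemma prodr_if_eq (R : comNzRingType) n k (c : R) :
  \prod_(j < n) (if j == k :> nat then c else 1) = if (k < n)%N then c else 1.
Proof.
case: ltnP => kn; last first.
  by apply: big1 => j _; case: eqP => // jk; have := ltn_ord j; lia.
by rewrite -big_mkcond (big_pred1 (Ordinal kn)).
Qed.

(** * Arithmetic in F_p for p = 2n + 1 *)

Section PrimeField.
Variables (p n : nat).
Hypotheses (p_pr : prime p) (pE : p = n.*2.+1).
Local Notation F := 'F_p.

Lemma Fp_natr_eq0 k : (k%:R == 0 :> F) = (p %| k)%N.
Proof. by rewrite (dvdn_pcharf (pchar_Fp p_pr)). Qed.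

Lemma Fp_natr_neq0 k : (0 < k < p)%N -> k%:R != 0 :> F.
Proof. by move=> /andP[k0 kp]; rewrite Fp_natr_eq0 gtnNdvd. Qed.

Lemma Fp_natr_opp k l : (k + l = p)%N -> k%:R = - l%:R :> F.
Proof.
move=> /(congr1 (fun i => i%:R : F)); rewrite natrD pchar_Fp_0 // => /eqP.
by rewrite addr_eq0 => /eqP.
Qed.

Lemma Fp_fact_neq0 k : (k < p)%N -> k`!%:R != 0 :> F.
Proof.
move=> kp; rewrite natr_fact; apply/prodf_neq0 => i _.
by apply: Fp_natr_neq0; rewrite /= (leq_ltn_trans _ kp).
Qed.

(** The residues n + 1, ..., 2n, read backwards, are -1, ..., -n. *)
Lemma prod_nonzero_residues (G : F -> F) :
  \prod_(i < n.*2) G i.+1%:R = \prod_(j < n) (G j.+1%:R * G (- j.+1%:R)).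
Proof.
rewrite -addnn big_split_ord big_split /=; congr (_ * _).
rewrite (reindex_inj rev_ord_inj); apply: eq_bigr => i _ /=.
by congr (G _); apply: Fp_natr_opp; have := ltn_ord i; lia.
Qed.

Lemma prod_Fp (G : F -> F) :
  \prod_x G x = G 0 * \prod_(j < n) (G j.+1%:R * G (- j.+1%:R)).
Proof.
have -> : \prod_x G x = \prod_(0 <= j < p) G j%:R.
  rewrite -(congr1 (fun k => \prod_(0 <= j < k) G j%:R) (Fp_cast p_pr)) big_mkord.
  by apply: eq_bigr => x _; rewrite natr_Zp.
by rewrite -prod_nonzero_residues (congr1 (fun k => \prod_(0 <= j < k) G j%:R) pE)
  big_nat_recl // big_mkord.
Qed.

(** Pairing j with -j turns Wilson's (2n)! = -1 into (-1)^n n!^2 = -1. *)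
Lemma fact_half_sqr : (n`!%:R : F) ^+ 2 = - (-1) ^+ n.
Proof.
have : (p.-1)`!.+1%:R == 0 :> F by rewrite Fp_natr_eq0 -Wilson ?prime_gt1.
rewrite -natr1 addr_eq0 (congr1 predn pE) natr_fact (prod_nonzero_residues id).
rewrite (eq_bigr (fun j : 'I_n => (-1) * (j.+1%:R * j.+1%:R))) => [|j _]; last by ring.
rewrite prodrMc big_split /= -natr_fact -expr2 => /eqP E.
by rewrite -[LHS](signrMK n) E mulrN1.
Qed.

Lemma fact_half4 : (n`!%:R : F) ^+ 4 = 1.
Proof. by rewrite (exprM _ 2 2) fact_half_sqr sqrrN sqrr_sign. Qed.

Lemma Fp_exp_half_sqr (a : F) : a != 0 -> (a ^+ n) ^+ 2 = 1.
Proof.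
move=> a0; apply: (mulfI a0); rewrite mulr1 -exprM -exprS muln2 -pE.
by have := expf_card a; rewrite card_Fp.
Qed.

(** * The row products P(a) of the overview *)

Definition sqr_row (a : F) : F := \prod_(j < n) sqr_nz (a - j.+1%:R).

Lemma sqr_rowN a : sqr_row (- a) = \prod_(j < n) sqr_nz (a + j.+1%:R).
Proof. by apply: eq_bigr => j _; rewrite -opprD sqr_nzN. Qed.

(** The left side is the product of [sqr_nz (a + x)] over all x in F_p. It is invariant under
    translation, and at a = 0 it equals n!^4 = 1. *)
Lemma sqr_row_mulN a : sqr_row a * sqr_row (- a) * sqr_nz a = 1.
Proof.
have prodE b : sqr_row b * sqr_row (- b) * sqr_nz b = \prod_x @sqr_nz F (b + x).
  rewrite prod_Fp addr0 mulrC big_split sqr_rowN /=; congr (_ * _).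
  by rewrite mulrC.
have -> : sqr_row a * sqr_row (- a) * sqr_nz a = sqr_row 0 * sqr_row (- 0) * sqr_nz 0.
  rewrite !prodE [RHS](reindex_inj (addrI a)).
  by apply: eq_bigr => x _; rewrite add0r.
rewrite oppr0 /sqr_row.
rewrite (eq_bigr (fun j : 'I_n => j.+1%:R ^+ 2)) => [|j _]; last first.
  rewrite sub0r sqr_nzN sqr_nz_id //; apply: Fp_natr_neq0.
  by have := ltn_ord j; lia.
by rewrite /sqr_nz eqxx mulr1 prodrXl -natr_fact -exprD fact_half4.
Qed.

(** Both sides are the product of [sqr_nz (a - j)] over 0 <= j <= n. *)
Lemma sqr_row_succ a : sqr_row (a + 1) * sqr_nz (a - n%:R) = sqr_nz a * sqr_row a.
Proof.
transitivity (\prod_(j < n.+1) sqr_nz (a - j%:R)).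
  rewrite big_ord_recr /=; congr (_ * _); apply: eq_bigr => j _.
  by rewrite -natr1 opprD addrACA subrr addr0.
by rewrite big_ord_recl subr0.
Qed.

Lemma sqr_rowN_succ a : sqr_row (- a) * sqr_row (a + 1) * sqr_nz (a - n%:R) = 1.
Proof. by rewrite -mulrA sqr_row_succ -[RHS](sqr_row_mulN a); ring. Qed.

(** Beyond the cut at m, the index n - t has double 2(n - t) = p - (2t + 1). *)
Lemma prod_doubles m (G : F -> F) : (m <= n)%N ->
  \prod_(i < n) G i.+1.*2%:R =
  \prod_(t < m) G t.*2.+2%:R * \prod_(t < n - m) G (- t.*2.+1%:R).
Proof.
move=> mn; have -> : \prod_(i < n) G i.+1.*2%:R = \prod_(i < m + (n - m)) G i.+1.*2%:R.
  by rewrite subnKC.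
rewrite big_split_ord /=; congr (_ * _).
rewrite (reindex_inj rev_ord_inj); apply: eq_bigr => t _ /=.
by congr (G _); apply: Fp_natr_opp; have := ltn_ord t; lia.
Qed.

Lemma prod_sqr_row_even m : n = m.*2 ->
  \prod_(i < n) sqr_row i.+1.*2%:R = - (2 ^+ m * m`!%:R) ^+ 2.
Proof.
move=> nE; have mn : (m <= n)%N by lia.
rewrite (prod_doubles m) //; have -> : (n - m = m)%N by lia.
set A := \prod_(t < m) _; set B := \prod_(t < m) _.
(* For a = 2t + 1 the leftover factor (a - n)^2 of [sqr_rowN_succ] is the square of an odd number
   below n. The odd product is reversed so that these factors match. *)
have BA : B * A * (\prod_(t < m) t.*2.+1%:R) ^+ 2 = 1.
  rewrite -prodrXl (reindex_inj rev_ord_inj) -!big_split /=.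
  apply: big1 => t _; rewrite -[RHS](sqr_rowN_succ t.*2.+1%:R) natr1; congr (_ * _).
  have -> : t.*2.+1%:R - n%:R = - (m - t.+1).*2.+1%:R :> F.
    by rewrite -opprB -natrB; [congr (- _%:R)|]; have := ltn_ord t; lia.
  rewrite sqr_nzN sqr_nz_id //; apply: Fp_natr_neq0.
  by have := ltn_ord t; lia.
have := prodr_even_odd F m; rewrite prodr_even -nE; set E := 2 ^+ m * _.
set O := \prod_(t < m) _ in BA *.
move=> /(congr1 (fun x => x ^+ 2)); rewrite fact_half_sqr nE -muln2 exprM sqrr_sign => EO.
by rewrite -[LHS]mulr1 -[1]opprK -EO -[E ^+ 2]mul1r -BA; ring.
Qed.

Lemma prod_sqr_row_odd m : n = m.*2.+1 ->
  \prod_(i < n) sqr_row i.+1.*2%:R * (2 ^+ m * m`!%:R) ^+ 2 = 1.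
Proof.
move=> nE; have mn : (m <= n)%N by lia.
rewrite (prod_doubles m) //; have -> : (n - m = m.+1)%N by lia.
rewrite big_ord_recr /= -nE.
(* Here n is odd, so the row -n has no partner. Taking a = n in [sqr_rowN_succ] gives P(-n) n!^2 =
   1, with n!^2 = 1. *)
have rown : sqr_row (- n%:R) = 1.
  have := sqr_rowN_succ n%:R; rewrite subrr [sqr_nz 0]/sqr_nz eqxx mulr1.
  rewrite natr1 {2}/sqr_row (reindex_inj rev_ord_inj) /=.
  rewrite (eq_bigr (fun j : 'I_n => j.+1%:R ^+ 2)) => [|j _]; last first.
    have jn := ltn_ord j.
    rewrite -natrB; last by lia.
    have -> : (n.+1 - (n - j.+1).+1 = j.+1)%N by lia.
    by rewrite sqr_nz_id //; apply: Fp_natr_neq0; lia.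
  rewrite prodrXl -natr_fact fact_half_sqr nE exprS -muln2 exprM sqrr_sign.
  by rewrite mulr1 opprK mulr1.
rewrite rown mulr1 mulrAC -prodr_even -prodrXl.
rewrite mulrC mulrA [X in _ * X](reindex_inj rev_ord_inj) -!big_split /=.
apply: big1 => t _; rewrite -[RHS](sqr_rowN_succ t.*2.+1%:R) natr1; congr (_ * _).
have -> : t.*2.+1%:R - n%:R = - (m - t.+1).*2.+2%:R :> F.
  by rewrite -opprB -natrB; [congr (- _%:R)|]; have := ltn_ord t; lia.
rewrite sqr_nzN sqr_nz_id //; apply: Fp_natr_neq0.
by have := ltn_ord t; lia.
Qed.

(** * Reduction of T_p to row products *)

Lemma Tp_sqr_rows (delta : int) : (3 < p)%N -> delta = 1 \/ delta = -1 ->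
  let D (i j : nat) : F := 2 * i.+1%:R + delta%:~R * j.+1%:R in
  (Tp p 2 (5 * delta) 2)%:~R *
    (\prod_(i < n) \prod_(j < n) if D i j == 0 then (3 * i.+1%:R) ^+ 2 else 1) =
  delta%:~R ^+ n * \prod_(i < n) \prod_(j < n) sqr_nz (D i j).
Proof.
move=> p3 deltaP D; set d : F := delta%:~R.
have d2 : d * d = 1 by rewrite /d; case: deltaP => ->; rewrite ?rmorphN ?rmorph1 ?mulrNN mulr1.
have three0 : 3 != 0 :> F by apply: Fp_natr_neq0; lia.
have DE i j : D i j = 2 * i.+1%:R + d * j.+1%:R by [].
pose nz (x : F) := if x == 0 then 1 else x.
have TE : (Tp p 2 (5 * delta) 2)%:~R = \prod_(i < n) \prod_(j < n) nz (d * D i j * D j i).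
  rewrite /Tp (congr1 predn pE) doubleK big_add1 big_mkord rmorph_prod.
  apply: eq_bigr => i _ /=; rewrite big_add1 big_mkord rmorph_prod big_mkcond.
  apply: eq_bigr => j _ /=; rewrite (dvdz_pcharf (pchar_Fp p_pr)).
  have -> : (qf 2 (5 * delta) 2 i.+1 j.+1)%:~R = d * D i j * D j i.
    rewrite /qf !DE !(rmorphD, rmorphM, rmorphXn) /= -/d -!pmulrn.
    transitivity (d * d * (2 * i.+1%:R ^+ 2 + 2 * j.+1%:R ^+ 2)
                  + (4 + d * d) * d * i.+1%:R * j.+1%:R : F); last by ring.
    rewrite d2; ring.
  by rewrite /nz; case: eqP.
(* T_p omits the whole factor when [D i j] vanishes, while the product of the squares keeps the
   cofactor [D j i]. So [k] restores that cofactor, whose square (3i)^2 is the correction on the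
   left, and [x] compensates the sign d, disappearing once squared. *)
pose k i j := if D i j == 0 then D j i else 1.
pose x i j := if D i j == 0 then d else 1.
have DD0 (i j : 'I_n) : D i j = 0 -> D j i = - (3 * d * i.+1%:R).
  rewrite !DE => /eqP; rewrite addr_eq0 => /eqP Dij.
  have -> : j.+1%:R = - (d * (2 * i.+1%:R)) by rewrite Dij mulrN opprK mulrA d2 mul1r.
  ring.
have d0 : d != 0 by apply: contra_eq_neq d2 => ->; rewrite mul0r eq_sym oner_neq0.
have DD (i j : 'I_n) : D i j = 0 -> D j i != 0.
  move=> /DD0->; rewrite oppr_eq0 !mulf_neq0 //; apply: Fp_natr_neq0.
  by have := ltn_ord i; lia.
have term (i j : 'I_n) : nz (d * D i j * D j i) * (k i j * k j i) =
    d * ((x i j * x j i) * (nz (D i j) * nz (D j i))).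
  rewrite /nz /k /x !mulf_eq0 (negbTE d0) /=.
  have [Dij|Dij] := eqVneq (D i j) 0.
    by rewrite (negbTE (DD _ _ Dij)) !mulr1 !mul1r mulrA d2 mul1r.
  have [Dji|Dji] := eqVneq (D j i) 0; last by rewrite /= !mulr1 mul1r mulrA.
  by rewrite !mulr1 !mul1r mulrA d2 mul1r.
have prod2M (f g : 'I_n -> 'I_n -> F) : \prod_(i < n) \prod_(j < n) (f i j * g i j) =
    (\prod_(i < n) \prod_(j < n) f i j) * \prod_(i < n) \prod_(j < n) g i j.
  by rewrite -big_split; apply: eq_bigr => i _; rewrite -big_split.
(* This is the symmetry i <-> j: multiplying over all ordered pairs counts each f(i,j) twice. *)
have prod_sym (f : nat -> nat -> F) : \prod_(i < n) \prod_(j < n) (f i j * f j i) =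
    \prod_(i < n) \prod_(j < n) (f i j ^+ 2).
  rewrite prod2M.
  rewrite [X in _ * X]exchange_big /= -big_split; apply: eq_bigr => i _ /=.
  by rewrite -big_split; apply: eq_bigr => j _ /=; rewrite expr2.
transitivity (\prod_(i < n) \prod_(j < n) (nz (d * D i j * D j i) * (k i j * k j i))).
  rewrite TE prod2M prod_sym.
  congr (_ * _); apply: eq_bigr => i _; apply: eq_bigr => j _.
  rewrite /k; case: eqP => [Dij|]; last by rewrite expr1n.
  by rewrite (DD0 _ _ Dij) sqrrN !exprMn [d ^+ 2]expr2 d2 mulr1.
rewrite (eq_bigr _ (fun i _ => eq_bigr _ (fun j _ => term i j))).
rewrite (eq_bigr _ (fun i _ => prodrMc _ _ _ _)) prodrMc -exprM.
rewrite prod2M (prod_sym x) (prod_sym (fun i j => nz (D i j))).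
rewrite big1 => [|i _]; last first.
  by apply: big1 => j _; rewrite /x; case: eqP; rewrite ?expr1n // expr2 d2.
rewrite mul1r; congr (_ * _); last first.
  apply: eq_bigr => i _; apply: eq_bigr => j _.
  by rewrite /nz /sqr_nz; case: eqP; rewrite ?expr1n.
(* The sign has exponent n * n, which has the parity of n. *)
rewrite /d; case: deltaP => ->; rewrite ?rmorphN ?rmorph1 ?expr1n //.
by rewrite -signr_odd oddM andbb signr_odd.
Qed.

(** In one-based indices the zero is at j = 2i, which is at most n exactly when i <= n/2. *)
Lemma prod_zeros_sub (c : nat -> F) :
  \prod_(i < n) \prod_(j < n)
    (if 2 * i.+1%:R + (-1) * j.+1%:R == 0 :> F then c i else 1) = \prod_(i < n./2) c i.
Proof.
rewrite [RHS](@big_ord_widen _ _ _ n./2 n c); last by lia.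
rewrite [RHS]big_mkcond; apply: eq_bigr => i _; have i_n := ltn_ord i.
have -> : (i < n./2)%N = (i.*2.+1 < n)%N by lia.
rewrite -[RHS]prodr_if_eq; apply: eq_bigr => j _; have jn := ltn_ord j.
congr (if _ then _ else _); rewrite mulN1r -natrM subr_eq0.
apply/eqP/eqP => [|->]; last by congr (_%:R); lia.
move=> /(congr1 (fun x : F => x : nat)) /=; rewrite !val_Fp_nat // !modn_small; lia.
Qed.

(** In one-based indices the zero is at j = p - 2i, which is at most n exactly when i > n/2; these
    rows complement those of [prod_zeros_sub]. *)
Lemma prod_zeros_add (c : nat -> F) :
  \prod_(i < n) \prod_(j < n)
    (if 2 * i.+1%:R + 1 * j.+1%:R == 0 :> F then c i else 1) * \prod_(i < n./2) c i
  = \prod_(i < n) c i.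
Proof.
rewrite [RHS](bigID (fun i : 'I_n => (i < n./2)%N)) mulrC; congr (_ * _).
  by rewrite -big_ord_widen //; lia.
rewrite [RHS]big_mkcond; apply: eq_bigr => i _; have i_n := ltn_ord i.
have -> : ~~ (i < n./2)%N = (n.*2 - i.*2 - 2 < n)%N by lia.
rewrite -[RHS]prodr_if_eq; apply: eq_bigr => j _; have jn := ltn_ord j.
congr (if _ then _ else _); rewrite mul1r -natrM -natrD Fp_natr_eq0.
(* The sum is positive and at most 3n < 2p, so the only possible multiple of p is p itself. *)
apply/idP/eqP => [/dvdnP[[|[|k]]]|jE]; rewrite ?mulSn; try by lia.
by apply/dvdnP; exists 1%N; lia.
Qed.

Let m := n./2.

Lemma Tp_minus : (3 < p)%N ->
  (Tp p 2 (5 * -1) 2)%:~R * (3 ^+ m * m`!%:R) ^+ 2 =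
  (-1) ^+ n * \prod_(i < n) sqr_row i.+1.*2%:R.
Proof.
move=> p3; have := Tp_sqr_rows (-1) p3 (or_intror erefl).
rewrite /= rmorphN1 (prod_zeros_sub (fun i => (3 * i.+1%:R) ^+ 2)).
rewrite prodrXl prodrMc -natr_fact => ->; congr (_ * _).
apply: eq_bigr => i _; apply: eq_bigr => j _.
by rewrite mulN1r -natrM mul2n.
Qed.

(** For delta = 1 the rows are P(-2i), which [sqr_row_mulN] relates to P(2i). The correction [K]
    runs over i > m and is traded for the one over i <= m through their product n!^2. *)
Lemma Tp_plus : (3 < p)%N ->
  (Tp p 2 (5 * 1) 2)%:~R * \prod_(i < n) sqr_row i.+1.*2%:R = (3 ^+ m * m`!%:R) ^+ 2.
Proof.
move=> p3; have := Tp_sqr_rows 1 p3 (or_introl erefl).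
rewrite /= rmorph1 expr1n mul1r; set K := \prod_(i < n) _; set B := \prod_(i < n) _ => TK.
have prodE k : \prod_(i < k) (3 * i.+1%:R) ^+ 2 = (3 ^+ k * k`!%:R) ^+ 2 :> F.
  by rewrite prodrXl prodrMc -natr_fact.
have KE : K * (3 ^+ m * m`!%:R) ^+ 2 = n`!%:R ^+ 2.
  have := prod_zeros_add (fun i => (3 * i.+1%:R) ^+ 2); rewrite /= !prodE => ->.
  rewrite exprMn Fp_exp_half_sqr ?mul1r //; apply: Fp_natr_neq0; lia.
set Bm := \prod_(i < n) _.
have BB : Bm * B * n`!%:R ^+ 2 = 1.
  transitivity (Bm * B * (2 ^+ n * n`!%:R) ^+ 2).
    by rewrite exprMn Fp_exp_half_sqr ?mul1r //; apply: Fp_natr_neq0; lia.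
  rewrite natr_fact -prodrMc -prodrXl -!big_split /=; apply: big1 => i _.
  rewrite -natrM mul2n -[RHS](sqr_row_mulN i.+1.*2%:R) sqr_nz_id; last first.
    by apply: Fp_natr_neq0; have := ltn_ord i; lia.
  congr (_ * _ * _); rewrite sqr_rowN; apply: eq_bigr => j _.
  by rewrite mul1r.
have K0 : K != 0.
  by apply: contra_eq_neq KE => ->; rewrite mul0r eq_sym sqrf_eq0 Fp_fact_neq0 //; lia.
apply: (mulfI K0); rewrite KE.
rewrite mulrA [K * _]mulrC TK.
transitivity (n`!%:R ^+ 2 * (Bm * B * n`!%:R ^+ 2)); last by rewrite BB mulr1.
transitivity (n`!%:R ^+ 4 * (B * Bm)); first by rewrite fact_half4 mul1r.
ring.
Qed.

(** * Gauss's lemma for 2 and 3, and Euler's criterion *)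

Lemma exp2_half k : n = k.*2 -> 2 ^+ n = (-1) ^+ k :> F.
Proof.
move=> nE; have f0 : n`!%:R != 0 :> F by apply: Fp_fact_neq0; lia.
apply: (mulIf f0); rewrite [in LHS]natr_fact -prodrMc.
transitivity (\prod_(i < n) i.+1.*2%:R : F).
  by apply: eq_bigr => i _; rewrite -natrM mul2n.
(* The doubles are the even numbers up to n and the negatives of the k odd ones, so their product is
   (-1)^k n!. *)
rewrite (prod_doubles k id) /=; last by lia.
have -> : (n - k = k)%N by lia.
rewrite [X in _ * X](eq_bigr (fun t : 'I_k => -1 * t.*2.+1%:R)) => [|t _];
  last by rewrite mulN1r.
by rewrite prodrMc mulrCA prodr_even_odd -nE.
Qed.

Lemma Fp_natr_addp k : (p + k)%:R = k%:R :> F.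
Proof. by rewrite natrD pchar_Fp_0 // add0r. Qed.

(** The multiples 3i split into a values up to n, b values between n and p, and b values above p.
    Only the middle block, read backwards as p - 3i, contributes signs. For b - a = 0 or 1 the three
    blocks reduce to the residue classes modulo 3 in 1..n. *)
Lemma exp3_half_fact a b : n = (a + (b + b))%N -> (a <= b <= a.+1)%N ->
  3 ^+ n * n`!%:R =
  (-1) ^+ b * ((\prod_(t < a) (3 * t + 3)%:R) *
    (\prod_(t < b) (3 * t + 1 + (b - a))%:R) * (\prod_(t < b) (3 * t + 2 - (b - a))%:R)) :> F.
Proof.
move=> nE /andP[ab ba]; rewrite natr_fact -prodrMc.
transitivity (\prod_(i < a + (b + b)) (3 * i.+1)%:R : F).
  by rewrite -nE; apply: eq_bigr => i _; rewrite -natrM.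
rewrite !big_split_ord /= [RHS]mulrA [(-1) ^+ b * (_ * _)]mulrCA -prodrMc -mulrA.
congr (_ * (_ * _)).
- by apply: eq_bigr => t _; congr (_%:R); lia.
- rewrite (reindex_inj rev_ord_inj); apply: eq_bigr => t _ /=.
  by rewrite mulN1r; apply: Fp_natr_opp; have := ltn_ord t; lia.
- apply: eq_bigr => t _; rewrite -[RHS]Fp_natr_addp; congr (_%:R).
  by have := ltn_ord t; lia.
Qed.

Lemma exp3_half k : (n = 3 * k -> 3 ^+ n = (-1) ^+ k :> F)%N.
Proof.
move=> nE; have f0 : n`!%:R != 0 :> F by apply: Fp_fact_neq0; lia.
apply: (mulIf f0); rewrite (exp3_half_fact k k); try lia.
rewrite subnn nE -prodr_triples; congr (_ * (_ * _ * _)); apply: eq_bigr => t _.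
  by rewrite addn0.
by rewrite subn0.
Qed.

Lemma exp3_half2 k : n = (3 * k + 2)%N -> 3 ^+ n = (-1) ^+ k.+1 :> F.
Proof.
move=> nE; have f0 : n`!%:R != 0 :> F by apply: Fp_fact_neq0; lia.
apply: (mulIf f0); rewrite (exp3_half_fact k k.+1); try lia.
rewrite subSnn nE addn2 !factS !natrM -prodr_triples; congr (_ * _).
rewrite !big_ord_recr /=.
have -> : \prod_(t < k) (3 * t + 1 + 1)%:R = \prod_(t < k) (3 * t + 2)%:R :> F.
  by apply: eq_bigr => t _; congr (_%:R); lia.
have -> : \prod_(t < k) (3 * t + 2 - 1)%:R = \prod_(t < k) (3 * t + 1)%:R :> F.
  by apply: eq_bigr => t _; congr (_%:R); lia.
have -> : (3 * k + 2 - 1 = (3 * k).+1)%N by lia.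
have -> : (3 * k + 1 + 1 = (3 * k).+2)%N by lia.
ring.
Qed.

Lemma legendre_exp_half (a : int) : (0 < n)%N -> (legendre a p)%:~R = a%:~R ^+ n :> F.
Proof.
move=> n_gt0; have dvdP b : (p %| b)%Z = (b%:~R == 0 :> F) := dvdz_pcharf (pchar_Fp p_pr) b.
rewrite /legendre dvdP; case: eqVneq => [->|a0]; first by rewrite expr0n eqn0Ngt n_gt0.
case: existsP => [[x]|nsq].
  rewrite dvdP rmorphB rmorphXn /= -pmulrn subr_eq0 => /eqP xa.
  rewrite -xa -exprM mulnC exprM Fp_exp_half_sqr //.
  by apply: contra_neq a0 => x0; rewrite -xa x0 expr0n.
have /eqP := Fp_exp_half_sqr _ a0; rewrite sqrf_eq1 => /orP[/eqP an|/eqP->];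
  last by rewrite rmorphN1.
(* A non-square a with a^n = 1 would give X^n - 1 the n + 1 distinct roots a, 1^2, ..., n^2. *)
pose rs : seq F := a%:~R :: [seq i.+1%:R ^+ 2 | i : 'I_n].
have /max_poly_roots : 'X^n - 1 != 0 :> {poly F} by rewrite -size_poly_eq0 size_Xn_sub_1.
move=> /(_ rs); rewrite size_Xn_sub_1 //= size_map -cardE card_ord ltnn => absurd.
suff: false by []; apply: absurd.
  apply/andP; split; first by rewrite rootE !hornerE an subrr.
  apply/allP => _ /mapP[i _ ->]; rewrite rootE !hornerE -exprM mulnC exprM.
  rewrite Fp_exp_half_sqr ?subrr //; apply: Fp_natr_neq0.
  by have := ltn_ord i; lia.
apply/andP; split.
  apply/negP => /mapP[i _ ai]; apply: nsq.
  have ip : (i.+1 < p)%N by have := ltn_ord i; lia.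
  by exists (Ordinal ip); rewrite dvdP rmorphB rmorphXn /= -pmulrn subr_eq0 ai.
rewrite map_inj_uniq ?enum_uniq // => i j /eqP.
have [i_n jn] := (ltn_ord i, ltn_ord j).
rewrite eqf_sqr => /orP[/eqP|].
  move=> /(congr1 (fun x : F => x : nat)) /=; rewrite !val_Fp_nat // !modn_small; try lia.
  by case=> ij; apply: val_inj.
by rewrite -addr_eq0 -natrD Fp_natr_eq0 gtnNdvd //; lia.
Qed.

End PrimeField.

(* Congruences mod p are stated as equalities in the prime field 'F_p;
   negative powers are inverses in 'F_p. *)
Theorem theorem1p6 (p : nat) (delta : int) :
  prime p -> (3 < p)%N -> (delta = 1 \/ delta = -1) ->
  ((p %% 4 = 1)%N ->
     ((Tp p 2 (5 * delta) 2)%:~R : 'F_p) = (-1) ^+ ((p + 11) %/ 12)%N) /\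
  ((p %% 4 = 3)%N ->
     ((Tp p 2 (5 * delta) 2)%:~R : 'F_p) =
       (legendre 6 p)%:~R * delta%:~R * ((2%:R : 'F_p) ^ delta) / ((3%:R : 'F_p) ^ delta)
       * (('C((p - 3) %/ 2, (p - 3) %/ 4))%:R : 'F_p) ^ (- (2 * delta))).
Proof.
move=> p_pr p_gt3 deltaP; pose n := p./2.
have pE : p = n.*2.+1.
  by have [|p_odd] := even_prime p_pr; lia.
have n_gt0 : (0 < n)%N by lia.
have two0 : 2 != 0 :> 'F_p by apply: Fp_natr_neq0; lia.
have three0 : 3 != 0 :> 'F_p by apply: Fp_natr_neq0; lia.
have f0 : (n./2)`!%:R != 0 :> 'F_p by apply: Fp_fact_neq0; lia.
have Tm := Tp_minus _ _ p_pr pE p_gt3; have Tq := Tp_plus _ _ p_pr pE p_gt3.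
split => p4.
  pose m := n./2; have nE : n = m.*2 by rewrite /m; lia.
  rewrite (prod_sqr_row_even _ _ p_pr pE _ nE) -/m in Tm Tq f0 *.
  have e2 := exp2_half _ _ p_pr pE _ nE.
  (* The exponent is chosen so that, with 2^n = (-1)^m, the sign -(2^n 3^n) becomes the one
     claimed. *)
  have e3 : 3 ^+ n = (-1) ^+ (m + ((p + 11) %/ 12).+1) :> 'F_p.
    have p3 : (p %% 3 != 0)%N.
      by rewrite -/(dvdn 3 p) dvdn_prime2 //; apply/eqP; lia.
    (* If n were 1 modulo 3, then 3 would divide p = 2n + 1. *)
    have [k [nk|nk]] : exists k, n = (3 * k)%N \/ n = (3 * k + 2)%N.
      by exists (n %/ 3)%N; lia.
    - rewrite (exp3_half _ _ p_pr pE _ nk) -signr_odd -[RHS]signr_odd.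
      by congr (_ ^+ nat_of_bool _); lia.
    - rewrite (exp3_half2 _ _ p_pr pE _ nk) -signr_odd -[RHS]signr_odd.
      by congr (_ ^+ nat_of_bool _); lia.
  have halfE (x : 'F_p) : (x ^+ m * m`!%:R) ^+ 2 = x ^+ n * m`!%:R ^+ 2.
    by rewrite exprMn -exprM muln2 -nE.
  have f20 : m`!%:R ^+ 2 != 0 :> 'F_p by rewrite sqrf_eq0.
  (* Both values of delta lead to -(2^n 3^n), because 2^n and 3^n square to 1 and m!^2 cancels. *)
  have -> : (-1) ^+ ((p + 11) %/ 12) = - (2 ^+ n * 3 ^+ n) :> 'F_p.
    by rewrite e2 e3 exprD mulrA -expr2 sqrr_sign mul1r exprS mulN1r opprK.
  rewrite !halfE in Tm Tq; case: deltaP => ->.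
    apply: (mulIf (expf_neq0 n two0)); apply: (mulIf f20).
    rewrite -mulrA -[LHS]opprK -mulrN Tq mulNr mulrAC -expr2.
    by rewrite (Fp_exp_half_sqr _ _ p_pr pE) // mul1r mulNr.
  apply: (mulIf (expf_neq0 n three0)); apply: (mulIf f20).
  rewrite -mulrA Tm [in (-1) ^+ n]nE -muln2 exprM sqrr_sign mul1r.
  rewrite mulNr -mulrA -expr2 (Fp_exp_half_sqr _ _ p_pr pE) // mulr1.
  by rewrite mulNr.
pose m := n./2; have nE : n = m.*2.+1 by rewrite /m; lia.
have sgn : (-1) ^+ n = -1 :> 'F_p by rewrite nE exprS -muln2 exprM sqrr_sign mulr1.
have := prod_sqr_row_odd _ _ p_pr pE _ nE.
set B := \prod_(i < n) _ in Tm Tq * => BE.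
have -> : ((p - 3) %/ 2 = m.*2)%N by lia.
have -> : ((p - 3) %/ 4 = m)%N by lia.
rewrite (legendre_exp_half _ _ p_pr pE) //.
rewrite -/m in Tm Tq f0; have -> : 6%:~R = 6 :> 'F_p by [].
set L := 6 ^+ n; set f := m`!%:R in f0 Tm Tq BE *; set c := 'C(_, _)%:R.
(* [X] will be T_p for delta = 1 and -1/T_p for delta = -1. *)
pose X : 'F_p := (6 ^+ m * f ^+ 2) ^+ 2.
have XE : X = (2 ^+ m * f) ^+ 2 * (3 ^+ m * f) ^+ 2.
  rewrite /X -exprMn mulrACA -exprMn -expr2; congr ((_ ^+ _ * _) ^+ _).
  by rewrite -natrM.
have six0 : 6 != 0 :> 'F_p by rewrite (natrM _ 2 3) mulf_neq0.
have LL : L ^+ 2 = 1 by apply: Fp_exp_half_sqr.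
have LX : 6 * X = L * f ^+ 4.
  have -> : L = 6 * (6 ^+ m) ^+ 2 by rewrite /L nE exprS -muln2 exprM.
  rewrite /X; ring.
(* This follows from n! = n c f^2, from n!^2 = 1 for odd n, and from 2n = -1 in F_p. *)
have cE : c ^+ 2 * f ^+ 4 = 4.
  have n2 : 2 * n%:R = -1 :> 'F_p.
    by rewrite -natrM (Fp_natr_opp _ p_pr _ 1) //; lia.
  have nf : n%:R * (c * f ^+ 2) = n`!%:R :> 'F_p.
    rewrite nE factS -(bin_fact (_ : m <= m.*2)%N); last by lia.
    have -> : (m.*2 - m = m)%N by lia.
    by rewrite !natrM.
  have := fact_half_sqr _ _ p_pr pE; rewrite -nf sgn opprK => nf2.
  transitivity ((2 * n%:R) ^+ 2 * (c ^+ 2 * f ^+ 4)); first by rewrite n2 sqrrN expr1n mul1r.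
  transitivity (4 * (n%:R * (c * f ^+ 2)) ^+ 2); first by ring.
  by rewrite nf2 mulr1.
have c0 : c != 0.
  apply: contra_eq_neq cE => ->; rewrite expr0n mul0r eq_sym (natrM _ 2 2).
  by rewrite mulf_neq0.
(* Eliminating f expresses [X] through the binomial coefficient and the Legendre symbol [L] of 6;
   both cases follow from this relation. *)
have cX : 6 * c ^+ 2 * X = 4 * L by rewrite mulrAC LX -cE; ring.
case: deltaP => ->.
  have -> : (Tp p 2 (5 * 1) 2)%:~R = X by rewrite XE -Tq [RHS]mulrC -mulrA BE [RHS]mulr1.
  have k0 : 6 * c ^+ 2 != 0 by rewrite mulf_neq0 // sqrf_eq0.
  apply: (mulfI k0); rewrite cX rmorph1 !expr1z -invr_expz.
  have -> : c ^ (2 * 1) = c ^+ 2 by [].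
  by field; rewrite c0 three0.
have TX : (Tp p 2 (5 * -1) 2)%:~R * X = -1.
  by rewrite XE mulrCA Tm sgn mulN1r mulrN mulrC BE.
have X0 : X != 0 by apply: contra_eq_neq TX => ->; rewrite mulr0 eq_sym oppr_eq0 oner_neq0.
apply: (mulIf X0); rewrite TX rmorphN1.
have -> : - (2 * -1) = 2 :> int by [].
have -> : c ^ 2 = c ^+ 2 by [].
rewrite !exprN1 invrK.
have k0 : 2 * 2 != 0 :> 'F_p by rewrite mulf_neq0.
apply: (mulfI k0).
transitivity (- (L * (6 * c ^+ 2 * X))); last by field.
transitivity (- (4 * L ^+ 2)); first by rewrite LL; ring.
by rewrite cX; ring.
Qed.
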